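(* Let $L$ be a C-loop with left representation $\Pi_\lambda$ and right representation $\Pi_\rho$. (1) If $\alpha\in\Pi_\lambda$, then $\alpha^n\in\Pi_\lambda$ for all $n\in\mathbb{Z}$. (2) If $\alpha\in\Pi_\rho$, then $\alpha^n\in\Pi_\rho$ for all $n\in\mathbb{Z}$.
   Context: A loop is a quasigroup with a two-sided identity element. For $x$ in a loop $L$, the translations $L_x,R_x:L\to L$ are the bijections $yL_x=xy$ and $yR_x=yx$. The left representation of $L$ is $\Pi_\lambda=\{L_x : x\in L\}$ and the right representation is $\Pi_\rho=\{R_x : x\in L\}$. Powers $\alpha^n$ are taken in the group of all bijections of $L$ under composition. $L$ is a C-loop if $x(y(yz))=((xy)y)z$ for all $x,y,z\in L$. *)

(* Defs.v *)
From HB Require Import structures.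
From mathcomp Require Import all_boot ssrint.
From mathcomp Require Import boolp classical_sets.

Set Implicit Arguments.
Unset Strict Implicit.
Unset Printing Implicit Defensive.

Local Open Scope group_scope.

HB.mixin Record Magma_isQuasigroup G of Magma G := {
  ldiv_unique : forall a b : G, exists! x, a * x = b;
  rdiv_unique : forall a b : G, exists! x, x * a = b
}.

#[short(type="quasigroupType")]
HB.structure Definition Quasigroup := { G of Magma_isQuasigroup G & Magma G }.

(* [BaseUMagma_isUMagma] states the same two laws, but HB only admits it on top *)
(* of a choiceType, and the carrier of a loop is an arbitrary type.            *)
HB.mixin Record BaseUMagma_isUnital G of BaseUMagma G := {
  mul1q : left_id (1 : G) *%g;
  mulq1 : right_id (1 : G) *%g
}.

#[short(type="loopType")]
HB.structure Definition Loop :=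
  { G of BaseUMagma_isUnital G & BaseUMagma G & Quasigroup G }.

Definition C_loop (L : loopType) : Prop :=
  forall x y z : L, x * (y * (y * z)) = ((x * y) * y) * z.

Record bijection (T : Type) := Bijection {
  bij_fun :> T -> T;
  bij_bijective : bijective bij_fun
}.

Section BijectionGroup.
Variable T : Type.
Implicit Types f g h : bijection T.

Lemma bijectionP f g : f =1 g -> f = g.
Proof.
case: f g => [f bf] [g bg] /= /funext fg.
by case: g / fg bg => bg; congr Bijection; exact: Prop_irrelevance.
Qed.

Definition bij_id : bijection T :=
  Bijection (Bijective (frefl (@id T)) (frefl (@id T))).

(* Maps act on the right, as in [perm]: y (f * g) = (y f) g.                   *)
Definition bij_mul f g : bijection T :=
  Bijection (bij_comp (bij_bijective g) (bij_bijective f)).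

Lemma bij_inv_subproof f : exists g : T -> T, cancel f g /\ cancel g f.
Proof. by case: (bij_bijective f) => g fK gK; exists g. Qed.

Definition bij_inv_fun f : T -> T := projT1 (cid (bij_inv_subproof f)).

Lemma bij_funK f : cancel f (bij_inv_fun f).
Proof. by rewrite /bij_inv_fun; case: cid => g []. Qed.

Lemma bij_inv_funK f : cancel (bij_inv_fun f) f.
Proof. by rewrite /bij_inv_fun; case: cid => g []. Qed.

Definition bij_inv f : bijection T :=
  Bijection (Bijective (bij_inv_funK f) (bij_funK f)).

Lemma bij_mulA : associative bij_mul.
Proof. by move=> f g h; apply: bijectionP. Qed.

Lemma bij_mul1 : left_id bij_id bij_mul.
Proof. by move=> f; apply: bijectionP. Qed.

Lemma bij_mulr1 : right_id bij_id bij_mul.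
Proof. by move=> f; apply: bijectionP. Qed.

Lemma bij_mulV : left_inverse bij_id bij_inv bij_mul.
Proof. by move=> f; apply: bijectionP => y; exact: bij_inv_funK. Qed.

Lemma bij_mulrV : right_inverse bij_id bij_inv bij_mul.
Proof. by move=> f; apply: bijectionP => y; exact: bij_funK. Qed.

HB.instance Definition _ := gen_eqMixin (bijection T).
HB.instance Definition _ := gen_choiceMixin (bijection T).
HB.instance Definition _ := isGroup.Build (bijection T)
  bij_mulA bij_mul1 bij_mulr1 bij_mulV bij_mulrV.

End BijectionGroup.

Definition expgz (G : groupType) (x : G) (n : int) : G :=
  match n with
  | Posz m => x ^+ m
  | Negz m => x ^- m.+1
  end.

Lemma exists_unique_bijective (T : Type) (f : T -> T) :
  (forall b, exists! x, f x = b) -> bijective f.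
Proof.
move=> f_uniq; have [g gK] := choice (fun b => f_uniq b).
exists g => [x|y]; last by case: (gK y).
by case: (gK (f x)) => _; apply.
Qed.

Section Translations.
Variable L : loopType.

Definition ltrans (x : L) : bijection L :=
  Bijection (@exists_unique_bijective L (fun y => x * y) (ldiv_unique x)).

Definition rtrans (x : L) : bijection L :=
  Bijection (@exists_unique_bijective L (fun y => y * x) (rdiv_unique x)).

End Translations.

Definition left_representation (L : loopType) : set (bijection L) :=
  range (@ltrans L).

Definition right_representation (L : loopType) : set (bijection L) :=
  range (@rtrans L).

Arguments left_representation : clear implicits.
Arguments right_representation : clear implicits.

(* Main.v *)
Require Import Defs.
From mathcomp Require Import all_boot ssrint.
From mathcomp Require Import boolp classical_sets.

(** The C-identity says that both representations are closed under
    [(a, b) |-> a^2 b]: it reads [L_y^2 L_x = L_((xy)y)] as well as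
    [R_y^2 R_z = R_(y(yz))].  Taking [xy = 1], resp. [yz = 1], gives
    [L_y^2 L_x = L_y], resp. [R_y^2 R_z = R_y], so they are closed under
    inverses.  Induction in steps of two yields all powers. *)

Local Open Scope group_scope.
Local Open Scope classical_set_scope.

Lemma expgz_closed (G : groupType) (S : set G) :
    S 1 -> (forall a, S a -> S a^-1) ->
    (forall a b, S a -> S b -> S (a * a * b)) ->
  forall a, S a -> forall n : int, S (expgz a n).
Proof.
move=> S1 SV SM.
have SX a (Sa : S a) n : S (a ^+ n).
  (* Closure only lets exponents grow by two, via [a * a * a ^+ n], so two consecutive powers are
     carried along. *)
  suff [] : S (a ^+ n) /\ S (a ^+ n.+1) by [].
  elim: n => [|n [IHn IHn1]]; first by rewrite expg1.
  by split=> //; rewrite !expgS mulgA; apply: SM.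
by move=> a Sa [n|n] /=; [apply: SX | apply/SV/SX].
Qed.

Section CLoop.
Variables (L : loopType) (hC : C_loop L).
Implicit Types x y z : L.

Lemma ltrans1 : ltrans (1 : L) = 1.
Proof. by apply: bijectionP => y; exact: mul1q. Qed.

Lemma rtrans1 : rtrans (1 : L) = 1.
Proof. by apply: bijectionP => y; exact: mulq1. Qed.

(** Maps act on the right, so at [z] the left side is [x * (y * (y * z))]. *)
Lemma ltrans_sqM x y : ltrans y * ltrans y * ltrans x = ltrans (x * y * y).
Proof. by apply: bijectionP => z; exact: hC. Qed.

Lemma rtrans_sqM y z : rtrans y * rtrans y * rtrans z = rtrans (y * (y * z)).
Proof. by apply: bijectionP => x; symmetry; exact: hC. Qed.

Lemma ltransV x y : x * y = 1 -> (ltrans y)^-1 = ltrans x.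
Proof.
(* Multiplied on the left by the square of [ltrans y], both sides become [ltrans y]. *)
move=> xy1; apply: (mulgI (ltrans y)); apply: (mulgI (ltrans y)).
by rewrite mulgV mulg1 mulgA ltrans_sqM xy1 mul1q.
Qed.

Lemma rtransV y z : y * z = 1 -> (rtrans y)^-1 = rtrans z.
Proof.
move=> yz1; apply: (mulgI (rtrans y)); apply: (mulgI (rtrans y)).
by rewrite mulgV mulg1 mulgA rtrans_sqM yz1 mulq1.
Qed.

End CLoop.

Theorem corollary3p1 (L : loopType) (hC : C_loop L) :
  (forall alpha : bijection L, alpha \in left_representation L ->
     forall n : int, expgz alpha n \in left_representation L) /\
  (forall alpha : bijection L, alpha \in right_representation L ->
     forall n : int, expgz alpha n \in right_representation L).
Proof.
split=> alpha /set_mem Salpha n; apply: mem_set; apply: expgz_closed Salpha n.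
- by exists 1 => //; exact: ltrans1.
(* The witness is the left inverse of [y]. *)
- move=> _ [y _ <-]; have [x [xy1 _]] := rdiv_unique y 1.
  by exists x => //; rewrite (ltransV _ hC _ _ xy1).
- move=> _ _ [y _ <-] [x _ <-].
  by exists (x * y * y) => //; rewrite (ltrans_sqM _ hC).
- by exists 1 => //; exact: rtrans1.
(* Dually, the right inverse of [y] serves for right translations. *)
- move=> _ [y _ <-]; have [z [yz1 _]] := ldiv_unique y 1.
  by exists z => //; rewrite (rtransV _ hC _ _ yz1).
- move=> _ _ [y _ <-] [z _ <-].
  by exists (y * (y * z)) => //; rewrite (rtrans_sqM _ hC).
Qed.
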